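(* Let $F$ be a scalar group and let $V$ be a near-vector space over $F$. For any $F$-subspace $W$ of $V$, the quotient set $V/W$ is a near-vector space over $F$ with the operations induced from those of $V$, i.e. $(v+W)+(w+W)=(v+w)+W$ and $\alpha\cdot(v+W)=(\alpha\cdot v)+W$ for $v,w\in V$, $\alpha\in F$. In particular, the quotient map $\pi:V\to V/W$ is a linear map with kernel $W$.
   Context: A scalar group is a tuple $F=(F,\cdot,1,0,-1)$ where $(F,\cdot,1)$ is a monoid, $0,-1\in F$, $0\cdot\alpha=0=\alpha\cdot 0$ for all $\alpha\in F$, $\{1,-1\}$ is the solution set of the equation $x^2=1$ in $F$, and $(F\setminus\{0\},\cdot,1)$ is a group. An $F$-space is an abelian group $(V,+)$ with a map $F\times V\to V$, $(\alpha,v)\mapsto\alpha\cdot v$, such that for all $\alpha,\beta\in F$, $v,w\in V$: $\alpha\cdot(\beta\cdot v)=(\alpha\cdot\beta)\cdot v$, $1\cdot v=v$, $\alpha\cdot(v+w)=\alpha\cdot v+\alpha\cdot w$, $(-1)\cdot v=-v$, $0\cdot v=0$. The quasi-kernel of an $F$-space $V$ is $Q(V)=\{v\in V\mid \forall \alpha,\beta\in F\ \exists\gamma\in F:\ \alpha\cdot v+\beta\cdot v=\gamma\cdot v\}$. A near-vector space over $F$ is an $F$-space $V$ whose action is free (if $\alpha\cdot v=\beta\cdot v$ then $v=0$ or $\alpha=\beta$) and such that $Q(V)$ generates $V$ as an additive group. An $F$-subspace of $V$ is a nonempty subset of $V$ closed under addition and scalar multiplication. A linear map between near-vector spaces over $F$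 is a map $f$ with $f(x+y)=f(x)+f(y)$ and $f(\alpha\cdot x)=\alpha\cdot f(x)$; its kernel is $\{v\mid f(v)=0\}$. *)

(* Defs.v *)
From HB Require Import structures.
From mathcomp Require Import all_boot all_order all_algebra all_classical.

Set Implicit Arguments.
Unset Strict Implicit.
Unset Printing Implicit Defensive.

Import GRing.Theory.
Local Open Scope classical_set_scope.
Local Open Scope ring_scope.

HB.mixin Record Monoid_isScalarGroup F of Monoid F := {
  szero : F;
  smone : F;
  smul0r : forall a : F, (szero * a = szero)%g;
  smulr0 : forall a : F, (a * szero = szero)%g;
  ssqr1 : forall a : F, (a * a = 1)%g <-> (a = 1%g \/ a = smone);
  (* the last three axioms say that F \ {0} is a group under the product of F,
     with neutral element 1 *)
  sone_neq0 : (1%g : F) <> szero;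
  smul_neq0 : forall a b : F, a <> szero -> b <> szero -> (a * b)%g <> szero;
  sinv_ex : forall a : F, a <> szero ->
    exists b : F, [/\ b <> szero, (a * b = 1)%g & (b * a = 1)%g]
}.

#[short(type="scalarGroupType")]
HB.structure Definition ScalarGroup := {F of Monoid_isScalarGroup F & Monoid F}.

Section NearVectorSpace.
Variables (F : scalarGroupType) (V : zmodType) (act : F -> V -> V).

Record fspace : Prop := FSpace {
  actA : forall (a b : F) (v : V), act a (act b v) = act (a * b)%g v;
  act1 : forall v : V, act 1%g v = v;
  actD : forall (a : F) (v w : V), act a (v + w) = act a v + act a w;
  actN1 : forall v : V, act smone v = - v;
  act0 : forall v : V, act szero v = 0
}.

Definition quasi_kernel : set V :=
  [set v | forall a b : F, exists c : F, act a v + act b v = act c v].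

Definition free_action : Prop :=
  forall (a b : F) (v : V), act a v = act b v -> v = 0 \/ a = b.

Definition generated_subgroup (A : set V) : set V :=
  smallest (fun H : set V => zmod_closed (mem H)) A.

Record near_vector_space : Prop := NearVectorSpace {
  nvs_fspace : fspace;
  nvs_free : free_action;
  nvs_generated : generated_subgroup quasi_kernel = setT
}.

Record fsubspace (W : set V) : Prop := FSubspace {
  fsub_nonempty : W !=set0;
  fsubD : forall v w : V, W v -> W w -> W (v + w);
  fsub_act : forall (a : F) (v : V), W v -> W (act a v)
}.

End NearVectorSpace.

Section LinearMap.
Variables (F : scalarGroupType) (V U : zmodType).
Variables (actV : F -> V -> V) (actU : F -> U -> U).

Definition linear_map (f : V -> U) : Prop :=
  (forall x y : V, f (x + y) = f x + f y) /\
  (forall (a : F) (x : V), f (actV a x) = actU a (f x)).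

Definition kernel (f : V -> U) : set V := [set v | f v = 0].

End LinearMap.

Section Quotient.
Variables (F : scalarGroupType) (V : zmodType) (act : F -> V -> V).
Hypothesis hV : near_vector_space act.
Variable W : set V.
Hypothesis hW : fsubspace act W.

Lemma fsubspace_zmod_closed : zmod_closed (mem W).
Proof.
have [[w0 Ww0] WD Wact] := hW; have hF := nvs_fspace hV.
split=> [|v w]; rewrite ?inE.
  by rewrite -(act0 hF w0); exact: Wact.
by move=> Wv Ww; apply: WD => //; rewrite -(actN1 hF); exact: Wact.
Qed.

Definition fsubspace_zmod : zmodClosed V :=
  HB.pack (mem W : V -> bool)
    (GRing.isZmodClosed.Build V (mem W) fsubspace_zmod_closed).

(* The library quotient of the abelian group V by the subgroup W, i.e. by the
   relation v - w \in W. *)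
Definition quotient_group : zmodType := @Quotient.quot V fsubspace_zmod.

Definition quotient_map : V -> quotient_group :=
  \pi_(@Quotient.quot V fsubspace_zmod)%qT.

End Quotient.

(* Main.v *)
Require Import Defs.
From mathcomp Require Import all_boot all_order all_algebra all_classical.

Set Implicit Arguments.
Unset Strict Implicit.
Unset Printing Implicit Defensive.

Import GRing.Theory.
Local Open Scope classical_set_scope.
Local Open Scope ring_scope.

(**
  Only the freeness of the action on V/W is not formal: if a <> b and
  av - bv is in W, then v must be in W.  Write v as a sum of elements x_i of
  the quasi-kernel Q; then w = av - bv is a sum of elements of the lines F x_i.
  A nonzero w in W with such an expression yields a nonzero q in W and in Q of
  the same form: if w is not in Q, then some aw + bw is not in Fw, and
  subtracting the multiple of w that cancels one component of aw + bw gives a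
  nonzero element of W with fewer components.  Subtracting a suitable multiple
  of q from v removes one of the x_i, leaves the class of v modulo W unchanged
  and preserves the hypothesis on v, so one concludes by induction.
*)

(** * Lines and sums of quasi-kernel elements in an F-space *)

Section FSpace.
Variables (F : scalarGroupType) (V : zmodType) (act : F -> V -> V).
Hypothesis hF : fspace act.

Let Q := quasi_kernel act.
Let line (v : V) : set V := range (act^~ v).

Lemma act_0r a : act a 0 = 0.
Proof. by apply: (addrI (act a 0)); rewrite -(actD hF) !addr0. Qed.

Lemma act_N a v : act a (- v) = - act a v.
Proof. by apply/eqP; rewrite -addr_eq0 -(actD hF) addNr act_0r. Qed.

Lemma act_B a v w : act a (v - w) = act a v - act a w.
Proof. by rewrite (actD hF) act_N. Qed.

Lemma act_sum (I : finType) a (x : I -> V) :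
  act a (\sum_i x i) = \sum_i act a (x i).
Proof. exact: (big_morph (act a) (actD hF a) (act_0r a)). Qed.

Lemma fsubspace_N W v : fsubspace act W -> W v -> W (- v).
Proof. by move=> hW Wv; rewrite -(actN1 hF); apply: (fsub_act hW). Qed.

Lemma fsubspace_B W v w : fsubspace act W -> W v -> W w -> W (v - w).
Proof. by move=> hW Wv Ww; apply: (fsubD hW) => //; apply: fsubspace_N. Qed.

Lemma line_refl v : line v v.
Proof. by exists 1%g => //; rewrite (act1 hF). Qed.

Lemma line_trans v w x : line v w -> line w x -> line v x.
Proof. by move=> [a _ <-] [b _ <-]; exists (b * a)%g; rewrite ?(actA hF). Qed.

Lemma fsubspace_line v : Q v -> fsubspace act (line v).
Proof.
move=> Qv; split=> [|_ _ [a _ <-] [b _ <-]|a _ [b _ <-]].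
- by exists v; apply: line_refl.
- by have [c ->] := Qv a b; exists c.
- by exists (a * b)%g; rewrite ?(actA hF).
Qed.

(** If w = av is nonzero then a is nonzero, hence invertible: any nonzero vector of a line spans
    it. *)
Lemma line_inv v w : line v w -> w <> 0 -> line w v.
Proof.
move=> [a _ <-] av0; have a0 : a <> szero.
  by move=> a0; apply: av0; rewrite a0 (act0 hF).
have [b [_ _ ba]] := sinv_ex a a0.
by exists b => //; rewrite (actA hF) ba (act1 hF).
Qed.

Lemma quasi_kernelP v :
  Q v <-> forall a b, line v (act a v + act b v).
Proof.
by split=> Qv a b; [have [c ->] := Qv a b; exists c|
                    have [c _ <-] := Qv a b; exists c].
Qed.

Lemma quasi_kernel_line v w : Q v -> line v w -> Q w.
Proof.
move=> Qv vw; have [->|/eqP w0] := eqVneq w 0.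
  by move=> a b; exists 1%g; rewrite !act_0r addr0.
apply/quasi_kernelP => a b; apply: line_trans (line_inv vw w0) _.
have hl := fsubspace_line Qv.
by apply: (fsubD hl); apply: (fsub_act hl).
Qed.

(** Since -1 acts as negation, Q is closed under opposites, so finite sums from Q already form a
    subgroup. *)
Lemma generated_subgroup_sum v : generated_subgroup Q v ->
  exists n (x : 'I_n -> V), (forall i, Q (x i)) /\ v = \sum_i x i.
Proof.
pose S := [set v | exists2 s : seq V,
  forall x, x \in s -> Q x & v = \sum_(x <- s) x].
suff /[apply] : generated_subgroup Q `<=` S.
  move=> [s Qs ->]; exists (size s), (fun i => nth 0 s i); split.
    by move=> i; apply/Qs/mem_nth.
  by rewrite (big_nth 0) big_mkord.
apply: smallest_sub => [|x Qx]; last first.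
  by exists [:: x] => [y|]; rewrite ?big_seq1 // inE => /eqP ->.
split=> [|v1 v2]; rewrite !inE; first by exists [::]; rewrite ?big_nil.
move=> [s1 Qs1 ->] [s2 Qs2 ->]; exists (s1 ++ map -%R s2).
  move=> x; rewrite mem_cat => /orP[/Qs1 //|/mapP[y /Qs2 Qy ->]].
  by apply: quasi_kernel_line Qy _; exists smone; rewrite ?(actN1 hF).
by rewrite big_cat big_map sumrN.
Qed.

(** Termination measure of both inductions below: moving each component within its line creates no
    new nonzero component. *)
Lemma card_support_lt (I : finType) (x y : I -> V) i :
  (forall j, line (x j) (y j)) -> x i != 0 -> y i = 0 ->
  (#|support y| < #|support x|)%N.
Proof.
move=> xy xi yi; apply/proper_card/fintype.properP; split.
  apply/fintype.subsetP => j; rewrite !inE; apply: contraNneq => xj.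
  by have [a _ <-] := xy j; rewrite xj act_0r.
by exists i; rewrite inE // yi eqxx.
Qed.

Lemma sum_neq0 (I : finType) (x : I -> V) :
  \sum_i x i <> 0 -> exists i, x i != 0.
Proof.
move=> x0; apply/existsP; apply: contra_notT x0; rewrite negb_exists.
by move/forallP => x0; apply: big1 => i _; apply/eqP; have := x0 i; rewrite negbK.
Qed.

(** Keeping each [y i] in the line of [x i] is what allows [fsubspace_cancel] to subtract
    componentwise. *)
Lemma fsubspace_quasi_kernel (W : set V) (I : finType) (x : I -> V) :
  fsubspace act W -> (forall i, Q (x i)) -> W (\sum_i x i) -> \sum_i x i <> 0 ->
  exists y : I -> V, [/\ forall i, line (x i) (y i), Q (\sum_i y i),
    W (\sum_i y i) & \sum_i y i <> 0].
Proof.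
move=> hW.
have [n] := ubnP #|support x|; elim: n x => // n IHn x.
rewrite ltnS => le_n Qx Wx x0.
have [/quasi_kernelP Qw|] := pselect (Q (\sum_i x i)).
  by exists x; split=> // [i|]; [apply: line_refl|apply/quasi_kernelP].
move=> /quasi_kernelP/existsNP[a /existsNP[b abx]].
have [i xi] := sum_neq0 x0.
have [c _ abxi] := (quasi_kernelP _).1 (Qx i) a b.
(* The scalar c is chosen for component i alone, so [z i] vanishes; the other components stay in
   their lines, which are closed under addition. *)
pose z j := act a (x j) + act b (x j) - act c (x j).
have zE : \sum_j z j =
    act a (\sum_j x j) + act b (\sum_j x j) - act c (\sum_j x j).
  by rewrite sumrB big_split /= !act_sum.
have xz j : line (x j) (z j).
  have hl := fsubspace_line (Qx j).
  have xj a' : line (x j) (act a' (x j)) by exists a'.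
  by apply: fsubspace_B => //; apply: (fsubD hl).
have zi : z i = 0 by rewrite /z -abxi subrr.
have [||||y [zy Qy Wy y0]] := IHn z.
- exact: leq_trans (card_support_lt xz xi zi) le_n.
- by move=> j; apply: quasi_kernel_line (Qx j) (xz j).
- by rewrite zE; apply: fsubspace_B => //; [apply: (fsubD hW)|];
    apply: (fsub_act hW).
(* If the new sum were 0, then aw + bw = cw would lie in the line of w, against the choice of a and
   b. *)
- by rewrite zE => /subr0_eq E; apply: abx; rewrite E; exists c.
by exists y; split=> // j; apply: line_trans (xz j) (zy j).
Qed.

Lemma fsubspace_cancel (W : set V) (a b : F) (I : finType) (x : I -> V) :
  free_action act -> fsubspace act W -> a <> b -> (forall i, Q (x i)) ->
  W (act a (\sum_i x i) - act b (\sum_i x i)) -> W (\sum_i x i).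
Proof.
move=> hfree hW ab.
have [n] := ubnP #|support x|; elim: n x => // n IHn x.
rewrite ltnS => le_n Qx Wx.
have [x0|/eqP x0] := eqVneq (\sum_i x i) 0.
  by move: Wx; rewrite x0 !act_0r subr0.
pose z i := act a (x i) - act b (x i).
have xz i : line (x i) (z i).
  by apply: fsubspace_B; [apply: fsubspace_line|exists a|exists b].
have zE : \sum_i z i = act a (\sum_i x i) - act b (\sum_i x i).
  by rewrite sumrB !act_sum.
have [|||y [zy Qy Wy y0]] := @fsubspace_quasi_kernel W _ z hW.
- by move=> i; apply: quasi_kernel_line (Qx i) (xz i).
- by rewrite zE.
- by rewrite zE => /subr0_eq/hfree[].
have xy i := line_trans (xz i) (zy i).
have [i yi] := sum_neq0 y0.
(* As [y i] is a nonzero vector of the line of [x i], some c gives c [y i] = [x i], so subtracting c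
   times the sum of [y] removes component i. *)
have [c _ cyi] := line_inv (xy i) (elimN eqP yi).
have Wcy : W (act c (\sum_j y j)) by apply: (fsub_act hW).
pose x' j := x j - act c (y j).
have x'E : \sum_j x' j = \sum_j x j - act c (\sum_j y j).
  by rewrite sumrB act_sum.
have xx' j : line (x j) (x' j).
  have hl := fsubspace_line (Qx j).
  by apply: fsubspace_B => //; [apply: line_refl|apply: (fsub_act hl)].
have x'i : x' i = 0 by rewrite /x' cyi subrr.
have xi : x i != 0.
  by apply: contra_neq yi => xi; have [d _ <-] := xy i; rewrite xi act_0r.
suff Wx' : W (\sum_j x' j).
  by rewrite -[\sum_j x j](subrK (act c (\sum_j y j))) -x'E; apply: (fsubD hW).
apply: IHn => [|j|].
- exact: leq_trans (card_support_lt xx' xi x'i) le_n.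
- exact: quasi_kernel_line (Qx j) (xx' j).
(* With s the old sum and q that of [y], regroup as (as - bs) - (acq - bcq); both brackets lie in
   W. *)
rewrite x'E !act_B opprD addrACA -opprD; apply: fsubspace_B => //.
by apply: fsubspace_B => //; apply: (fsub_act hW).
Qed.

End FSpace.

(** * Near-vector space structure on V/W *)

Section Quotient.
Variables (F : scalarGroupType) (V : zmodType) (act : F -> V -> V).
Hypothesis hV : near_vector_space act.
Variable W : set V.
Hypothesis hW : fsubspace act W.

Local Notation pi := (quotient_map hV hW).
Let hF := nvs_fspace hV.

Lemma quotient_mapD v w : pi (v + w) = pi v + pi w.
Proof. by rewrite /quotient_map raddfD. Qed.

Lemma quotient_mapB v w : pi (v - w) = pi v - pi w.
Proof. by rewrite /quotient_map raddfB. Qed.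

Lemma quotient_map0 : pi 0 = 0.
Proof. by rewrite /quotient_map raddf0. Qed.

Lemma quotient_map_surj q : exists v, q = pi v.
Proof. by exists (repr q); rewrite /quotient_map reprK. Qed.

Lemma quotient_map_eq v w : pi v = pi w <-> W (v - w).
Proof.
have E := Quotient.idealrBE (fsubspace_zmod hV hW) v w.
split=> [/eqP|Wvw]; first by rewrite /quotient_map -E inE.
by apply/eqP; rewrite /quotient_map -E inE.
Qed.

Definition quotient_act (a : F) (q : quotient_group hV hW) :
  quotient_group hV hW := pi (act a (repr q)).

(** Independence of the chosen representative: two representatives differ by an element of W, which
    the action preserves. *)
Lemma quotient_act_pi a v : quotient_act a (pi v) = pi (act a v).
Proof.
apply/quotient_map_eq; rewrite -(act_B hF); apply: (fsub_act hW).
by apply/quotient_map_eq; rewrite /quotient_map reprK.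
Qed.

Lemma quotient_fspace : fspace quotient_act.
Proof.
split=> [a b q|q|a q r|q|q]; have [v ->] := quotient_map_surj q.
- by rewrite !quotient_act_pi (actA hF).
- by rewrite quotient_act_pi (act1 hF).
- have [w ->] := quotient_map_surj r.
  by rewrite -quotient_mapD !quotient_act_pi (actD hF) quotient_mapD.
- by rewrite quotient_act_pi (actN1 hF) -sub0r quotient_mapB quotient_map0 sub0r.
- by rewrite quotient_act_pi (act0 hF) quotient_map0.
Qed.

Lemma quotient_free : free_action quotient_act.
Proof.
move=> a b q; have [v ->] := quotient_map_surj q.
rewrite !quotient_act_pi => /quotient_map_eq Wv.
have [->|ab] := pselect (a = b); [by right|left].
rewrite -quotient_map0; apply/quotient_map_eq; rewrite subr0.
have : generated_subgroup (quasi_kernel act) v by rewrite (nvs_generated hV).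
move=> /(generated_subgroup_sum hF)[n [x [Qx vE]]].
rewrite vE in Wv *.
exact: (fsubspace_cancel hF (nvs_free hV) hW ab Qx Wv).
Qed.

(** The projection sends Q(V) into Q(V/W), so the preimage of a subgroup containing Q(V/W) is a
    subgroup containing Q(V), hence all of V. *)
Lemma quotient_generated :
  generated_subgroup (quasi_kernel quotient_act) = setT.
Proof.
apply/seteqP; split=> // q _; have [v ->] := quotient_map_surj q.
move=> H [[H0 HB] QH].
suff : generated_subgroup (quasi_kernel act) `<=` [set v | H (pi v)].
  by apply; rewrite (nvs_generated hV).
apply: smallest_sub => [|w Qw]; last first.
  apply: QH => a b; have [c E] := Qw a b; exists c.
  by rewrite !quotient_act_pi -quotient_mapD E.
split=> [|w1 w2]; rewrite !inE /=.
  by rewrite quotient_map0; move: H0; rewrite inE.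
by rewrite quotient_mapB => H1 H2; have := HB (pi w1) (pi w2);
  rewrite !inE; apply.
Qed.

End Quotient.

Theorem theorem4p2 (F : scalarGroupType) (V : zmodType) (act : F -> V -> V)
    (hV : near_vector_space act) (W : set V) (hW : fsubspace act W) :
  exists actW : F -> quotient_group hV hW -> quotient_group hV hW,
    [/\ forall v w : V,
          quotient_map hV hW v + quotient_map hV hW w
          = quotient_map hV hW (v + w),
        forall (a : F) (v : V),
          actW a (quotient_map hV hW v) = quotient_map hV hW (act a v),
        near_vector_space actW,
        linear_map act actW (quotient_map hV hW) &
        kernel (quotient_map hV hW) = W].
Proof.
exists (@quotient_act _ _ _ hV _ hW); split.
- by move=> v w; rewrite quotient_mapD.
- exact: quotient_act_pi.
- split; first exact: quotient_fspace.
    exact: quotient_free.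
  exact: quotient_generated.
- split=> [x y|a x]; first exact: quotient_mapD.
  by rewrite quotient_act_pi.
- apply/seteqP; split=> v; rewrite /kernel /= -(quotient_map0 hV hW).
    by move=> /quotient_map_eq; rewrite subr0.
  by move=> Wv; apply/quotient_map_eq; rewrite subr0.
Qed.
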